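(* There exist a probability space $(\Omega,\mathcal{A},\mu)$, an invertible, ergodic, measure preserving transformation $T:\Omega\to\Omega$, a filtration $(\mathcal{F}_i)_{i\in\mathbb{Z}}$ of sub-$\sigma$-algebras of $\mathcal{A}$ with $\mathcal{F}_{i+1}=T^{-1}\mathcal{F}_i$ for all $i\in\mathbb{Z}$, an $\mathcal{F}_0$-measurable $f\in L_0^2(\mu)$, and a $g\in L^1(\mu)$ for which: (a) $f=g-g\circ T$; (b) $\displaystyle\limsup_{n\to\infty}\frac{E(S_n(f)|\mathcal{F}_0)}{\sqrt{n}}\ge 1$ with probability one.
   Context: ''Invertible'' means that $T$ is a bijection with measurable inverse. $L_0^2(\mu)=\{g\in L^2(\mu):\int g\,d\mu=0\}$ and $S_n(f)=\sum_{i=1}^n f\circ T^i$. A filtration is increasing: $\mathcal{F}_i\subseteq\mathcal{F}_{i+1}$. *)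

(* Defs.v *)
From HB Require Import structures.
From mathcomp Require Import all_boot all_order all_algebra.
From mathcomp Require Import all_classical all_reals all_analysis.

Set Implicit Arguments.
Unset Strict Implicit.
Unset Printing Implicit Defensive.
Import Order.TTheory GRing.Theory Num.Theory.
Import numFieldNormedType.Exports.
Local Open Scope classical_set_scope.
Local Open Scope ring_scope.

Definition measure_preserving d (Omega : measurableType d) (R : realType)
    (mu : probability Omega R) (T : Omega -> Omega) : Prop :=
  measurable_fun setT T /\
  forall A, measurable A -> mu (T @^-1` A) = mu A.

Definition invertible d (Omega : measurableType d) (T : Omega -> Omega) : Prop :=
  exists Tinv : Omega -> Omega,
    [/\ cancel T Tinv, cancel Tinv T & measurable_fun setT Tinv].

Definition ergodic d (Omega : measurableType d) (R : realType)
    (mu : probability Omega R) (T : Omega -> Omega) : Prop :=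
  forall A, measurable A -> T @^-1` A = A -> mu A = 0%E \/ mu A = 1%E.

Definition sub_sigma_algebra_of d (Omega : measurableType d)
    (F : set_system Omega) : Prop :=
  sigma_algebra setT F /\ F `<=` measurable.

Definition filtration d (Omega : measurableType d)
    (F : int -> set_system Omega) : Prop :=
  (forall i, sub_sigma_algebra_of (F i)) /\
  (forall i, F i `<=` F (i + 1)).

(* g_sigma_algebraType F is Omega equipped with the sigma-algebra <<s F >>,
   which is F itself when F is already a sigma-algebra. *)
Definition measurable_wrt d (Omega : measurableType d) (R : realType)
    (F : set_system Omega) (X : Omega -> R) : Prop :=
  measurable_fun [set: g_sigma_algebraType F] (X : g_sigma_algebraType F -> R).

Definition L20 d (Omega : measurableType d) (R : realType)
    (mu : probability Omega R) (f : Omega -> R) : Prop :=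
  f \in Lfun mu 2%:E /\ (\int[mu]_x (f x)%:E = 0)%E.

Definition birkhoff_sum (R : realType) (Omega : Type) (T : Omega -> Omega)
    (f : Omega -> R) (n : nat) (x : Omega) : R :=
  \sum_(1 <= i < n.+1) f (iter i T x).

Definition is_cond_exp d (Omega : measurableType d) (R : realType)
    (mu : probability Omega R) (F : set_system Omega) (X Y : Omega -> R)
    : Prop :=
  [/\ measurable_wrt F Y,
      mu.-integrable setT (EFin \o Y) &
      forall A, F A -> (\int[mu]_(x in A) (Y x)%:E = \int[mu]_(x in A) (X x)%:E)%E].

(* A chosen version of E(X | F), which is unique up to mu-null sets; the default
   value 0 is only taken when no version exists, which does not happen for
   integrable X and a sub-sigma-algebra F. *)
Definition cond_exp d (Omega : measurableType d) (R : realType)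
    (mu : probability Omega R) (F : set_system Omega) (X : Omega -> R)
    : Omega -> R :=
  xget (fun=> 0) [set Y | is_cond_exp mu F X Y].

(* Main.v *)
(* On the 2-adic integers with Haar measure, T x = x + 1 is invertible and
   ergodic: an invariant set meets the 2 ^ n residue classes modulo 2 ^ n in
   sets of equal measure, so it is independent of every cylinder, hence of
   itself. The filtration is the constant one, F_i being the whole
   sigma-algebra, which T preserves because it is invertible; so
   E(S_n f | F_0) = S_n f, and only h >= 0 in L^1 is needed such that h \o T - h
   is in L^2 while h (T^n x) >= 2 sqrt n infinitely often. Take h to be the
   supremum over k of tents living on the residues modulo 64 ^ k, of height
   3 * 8 ^ k and half-width 4 ^ k. The k-th tent has integral of order 2 ^- k and
   slope 3 * 2 ^ k on a set of measure of order 16 ^- k, so both series converge;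
   and every orbit meets its peak within 4 * 64 ^ k steps, where sqrt n is at
   most 2 * 8 ^ k. With g = - h, S_n f = h \o T^(n+1) - h \o T. *)

Require Import Defs.
From HB Require Import structures.
From mathcomp Require Import all_boot all_order all_algebra.
From mathcomp Require Import all_classical all_reals all_analysis.
From mathcomp Require Import measurable_realfun zify ring lra.

Set Implicit Arguments.
Unset Strict Implicit.
Unset Printing Implicit Defensive.
Import Order.TTheory GRing.Theory Num.Theory.
Import numFieldNormedType.Exports.
Local Open Scope classical_set_scope.
Local Open Scope ring_scope.

(** * The odometer on the 2-adic integers *)

(** Points are digit sequences, least significant digit first; [residue n x] is the reduction of x
    modulo 2 ^ n. *)
Fixpoint residue (n : nat) (x : nat -> bool) : nat :=
  if n is m.+1 then (residue m x + x m * 2 ^ m)%N else 0%N.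

(** Addition of 1: the carry reaches digit i exactly when all lower digits are 1, that is, when
    their residue is 2 ^ i - 1. *)
Definition odometer (x : nat -> bool) : nat -> bool :=
  fun i => x i (+) ((residue i x).+1 == 2 ^ i)%N.

(** Subtraction of 1: the borrow reaches digit i exactly when all lower digits are 0. *)
Definition odometer_inv (x : nat -> bool) : nat -> bool :=
  fun i => x i (+) (residue i x == 0)%N.

Lemma residue_lt n x : (residue n x < 2 ^ n)%N.
Proof. by elim: n => //= n IH; rewrite expnS; case: (x n); lia. Qed.

Lemma residue_inj n x y i :
  residue n x = residue n y -> (i < n)%N -> x i = y i.
Proof.
elim: n => //= n IH; have := residue_lt n x; have := residue_lt n y.
move=> hy hx; rewrite ltnS leq_eqVlt.
case xn: (x n); case yn: (y n); try lia; move=> e /orP[/eqP ->|];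
  rewrite ?xn ?yn //; apply: IH; lia.
Qed.

Lemma residue_ext n x y :
  (forall i, (i < n)%N -> x i = y i) -> residue n x = residue n y.
Proof.
elim: n => //= n IH h; rewrite h// IH// => i hi; apply: h; lia.
Qed.

Lemma eq_residue x y : (forall n, residue n x = residue n y) -> x = y.
Proof. by move=> h; apply/funext => i; exact: (residue_inj (h i.+1)). Qed.

Lemma residue_bits n j :
  residue n (fun i => odd (j %/ 2 ^ i)) = (j %% 2 ^ n)%N.
Proof.
elim: n => [|n IH] /=; first by rewrite expn0 modn1.
rewrite IH -modn2 [in RHS](divn_eq j (2 ^ n)).
rewrite [in RHS](divn_eq (j %/ 2 ^ n) 2) mulnDl -mulnA -expnS -addnA modnMDl.
rewrite [RHS]modn_small; last first.
  rewrite expnS; have: (j %% 2 ^ n < 2 ^ n)%N by rewrite ltn_mod expn_gt0.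
  have: (j %/ 2 ^ n %% 2 < 2)%N by rewrite ltn_mod.
  move: (j %/ 2 ^ n %% 2)%N => q; move: (j %% 2 ^ n)%N => r.
  move: (2 ^ n)%N => p q2 rp.
  by case: q q2 => [|[|]]; lia.
by rewrite addnC.
Qed.

Lemma residue_odometer n x :
  residue n (odometer x) = ((residue n x).+1 %% 2 ^ n)%N.
Proof.
elim: n => [|n IH] /=; first by rewrite expn0 modn1.
rewrite IH /odometer; have := residue_lt n x; have [e _|ne lt] := eqVneq.
  rewrite e modnn addbT -addSn e; case: (x n) => /=.
    by rewrite mul1n addnn -mul2n -expnS modnn.
  by rewrite mul1n addn0 modn_small// ltn_exp2l.
rewrite addbF modn_small; last lia.
rewrite modn_small; first lia.
rewrite expnS; case: (x n); lia.
Qed.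

(** The summand [(2 ^ n).-1] stands for -1 modulo 2 ^ n, since subtraction on [nat] is truncated. *)
Lemma residue_odometer_inv n x :
  residue n (odometer_inv x) = ((residue n x + (2 ^ n).-1) %% 2 ^ n)%N.
Proof.
elim: n => [|n IH] /=; first by rewrite expn0 modn1.
rewrite IH /odometer_inv; have := residue_lt n x; have [->|ne] := eqVneq => lt.
  have p0 := expn_gt0 2 n.
  rewrite addbT add0n add0n (modn_small (_ : (_ < 2 ^ n)%N)); last lia.
  case: (x n); rewrite /= ?mul0n ?mul1n ?addn0 ?add0n.
    have -> : (2 ^ n + (2 ^ n.+1).-1 = 1 * 2 ^ n.+1 + (2 ^ n).-1)%N.
      by rewrite expnS; lia.
    by rewrite modnMDl modn_small// expnS; lia.
  by rewrite modn_small expnS; lia.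
have -> : (residue n x + (2 ^ n).-1 = 1 * 2 ^ n + (residue n x).-1)%N by lia.
have -> : (residue n x + x n * 2 ^ n + (2 ^ n.+1).-1 =
           1 * 2 ^ n.+1 + ((residue n x).-1 + x n * 2 ^ n))%N.
  by have := expn_gt0 2 n.+1; lia.
rewrite addbF !modnMDl !modn_small//; last lia.
by rewrite expnS; case: (x n); lia.
Qed.

Lemma odometerK : cancel odometer odometer_inv.
Proof.
move=> x; apply: eq_residue => n.
rewrite residue_odometer_inv residue_odometer modnDml addSnnS.
rewrite prednK ?expn_gt0//.
by rewrite modnDr modn_small// residue_lt.
Qed.

Lemma odometer_invK : cancel odometer_inv odometer.
Proof.
move=> x; apply: eq_residue => n.
rewrite residue_odometer residue_odometer_inv -addn1 modnDml addn1 -addnS.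
by rewrite prednK ?expn_gt0// modnDr modn_small// residue_lt.
Qed.

Lemma residue_iter m n x :
  residue n (iter m odometer x) = ((residue n x + m) %% 2 ^ n)%N.
Proof.
elim: m => [|m IH] /=; first by rewrite addn0 modn_small// residue_lt.
by rewrite residue_odometer IH -addn1 modnDml addn1 addnS.
Qed.

(** * The sigma-algebra generated by the cylinders *)

Definition cylinders : set_system (nat -> bool) :=
  [set A | exists n j, A = [set x | residue n x = j]].

Definition dyadic_integers := g_sigma_algebraType cylinders.

HB.instance Definition _ := Measurable.on dyadic_integers.

Lemma measurable_residue n j :
  measurable ([set x | residue n x = j] : set dyadic_integers).
Proof. by apply: sub_sigma_algebra; exists n, j. Qed.

Lemma measurable_residueP n (P : set nat) :
  measurable ([set x | P (residue n x)] : set dyadic_integers).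
Proof.
have -> : [set x | P (residue n x)] =
    \bigcup_(j in P) [set x | residue n x = j].
  by apply/seteqP; split=> [x Px|x [j Pj /= ->]//]; exists (residue n x).
by apply: bigcup_measurable => j _; exact: measurable_residue.
Qed.

Lemma residue_le m n x y : (m <= n)%N ->
  residue n x = residue n y -> residue m x = residue m y.
Proof.
by move=> mn e; apply: residue_ext => i im; apply: (residue_inj e); lia.
Qed.

(** A residue modulo 2 ^ n determines the one modulo 2 ^ m for m <= n, so two cylinders are nested
    or disjoint. This gives the pi-system on which measures are compared. *)
Lemma setI_closed_cylinders : setI_closed cylinders.
Proof.
suff h m n i j : (m <= n)%N ->
    cylinders ([set x | residue m x = i] `&` [set x | residue n x = j]).
  move=> _ _ [m [i ->]] [n [j ->]]; have [|/ltnW] := leqP m n; first exact: h.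
  by rewrite setIC; exact: h.
move=> mn; set B := [set x | residue n x = j].
have [[x [/= xi xj]]|ne] :=
  pselect (exists x, [set x | residue m x = i] x /\ B x).
  exists n, j; apply/seteqP; split=> [y []//|y yj]; split=> //=.
  by rewrite -xi; apply: (residue_le mn); rewrite xj; exact: yj.
(* [residue 0] is constantly 0, so this cylinder is empty. *)
exists 0%N, 1%N; apply/seteqP; split=> [y [yi yj]|y //].
by case: ne; exists y.
Qed.

Lemma measurable_to_dyadic d (X : measurableType d) (D : set X)
    (f : X -> dyadic_integers) :
  (forall n j, measurable (D `&` [set x | residue n (f x) = j])) ->
  measurable_fun D f.
Proof.
move=> h.
refine (@measurability _ _ X dyadic_integers D f cylinders erefl _).
by move=> _ [_ [n [j ->]] <-]; exact: h.
Qed.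

Lemma measurable_odometer :
  measurable_fun setT (odometer : dyadic_integers -> dyadic_integers).
Proof.
apply: measurable_to_dyadic => n j; rewrite setTI.
under eq_set do rewrite residue_odometer.
exact: (measurable_residueP n [set r | (r.+1 %% 2 ^ n)%N = j]).
Qed.

Lemma measurable_odometer_inv :
  measurable_fun setT (odometer_inv : dyadic_integers -> dyadic_integers).
Proof.
apply: measurable_to_dyadic => n j; rewrite setTI.
under eq_set do rewrite residue_odometer_inv.
exact: (measurable_residueP n [set r | ((r + (2 ^ n).-1) %% 2 ^ n)%N = j]).
Qed.

Lemma dyadic_measure_unique (R : realType)
    (m1 m2 : {measure set dyadic_integers -> \bar R}) :
  (m1 setT < +oo)%E ->
  (forall n j, (j < 2 ^ n)%N ->
    m1 [set x | residue n x = j] = m2 [set x | residue n x = j]) ->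
  forall A, measurable A -> m1 A = m2 A.
Proof.
move=> m1oo h.
apply: (@measure_unique _ R dyadic_integers cylinders (fun=> setT)) => //.
- exact: setI_closed_cylinders.
- by move=> _; exists 0%N, 0%N; apply/seteqP; split.
- by apply/seteqP; split=> // x _; exists 0%N.
- move=> _ [n [j ->]]; have [/h //|ge] := ltnP j (2 ^ n).
  suff -> : [set x | residue n x = j] = set0 by rewrite !measure0.
  by apply/seteqP; split=> x //= e; have := residue_lt n x; lia.
Qed.

(** * Haar measure *)

(** Haar measure is obtained as the image of Lebesgue measure on [0, 1[ under binary expansion.
    Outside [0, 1[ the zero sequence is a default value, invisible to the restricted measure. *)
Definition binary_digits (R : realType) (u : R) : nat -> bool :=
  fun i => (0 <= u < 1) && odd (Num.truncn (2 ^+ i.+1 * u)).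

(* Unlike [residue], this reads the first [n] digits with the most significant
   one first. *)
Fixpoint binary_prefix (n : nat) (b : nat -> bool) : nat :=
  if n is m.+1 then (2 * binary_prefix m b + b m)%N else 0%N.

Lemma binary_prefix_lt n b : (binary_prefix n b < 2 ^ n)%N.
Proof. by elim: n => //= n IH; rewrite expnS; case: (b n); lia. Qed.

Lemma binary_digitsP (R : realType) (u : R) n b : 0 <= u < 1 ->
  (forall i, (i < n)%N -> binary_digits u i = b i) <->
  (binary_prefix n b)%:R <= 2 ^+ n * u < (binary_prefix n b).+1%:R.
Proof.
move=> u01; elim: n => [|n IH] /=.
  by rewrite expr0 mul1r; split.
move: (binary_prefix n b) IH => v IH.
(* If v is the floor of y, then the floor of 2 y is 2 v or 2 v + 1, and its parity is the next
   digit. *)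
have step (y : R) : v%:R <= y < v.+1%:R ->
    odd (Num.truncn (2 * y)) = b n <->
    (2 * v + b n)%:R <= 2 * y < (2 * v + b n).+1%:R.
  move=> /andP[vy yv]; have y0 : 0 <= 2 * y by have := ler0n R v; lra.
  split=> [bn|/truncn_def ->]; last by rewrite oddD mul2n odd_double oddb.
  have := truncn_itv y0; move: bn; set t := Num.truncn _ => bn ty.
  suff -> : (2 * v + b n)%N = t by [].
  have t1 : (2 * v <= t)%N.
    rewrite -ltnS -(ltr_nat R) (le_lt_trans _ (andP ty).2)// natrM; lra.
  have t2 : (t < 2 * v.+1)%N.
    rewrite -(ltr_nat R) (le_lt_trans (andP ty).1)// natrM; lra.
  move: (odd_double_half t) bn t1 t2; clear; move: (b n) => c th <-.
  by move: th; case: (odd t) => /=; lia.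
rewrite exprS -mulrA; split=> [h|h].
  have hn : v%:R <= 2 ^+ n * u < v.+1%:R by apply/IH => i hi; apply: h; lia.
  by apply/(step _ hn); rewrite -h// /binary_digits u01 exprS mulrA.
have hn : v%:R <= 2 ^+ n * u < v.+1%:R.
  move: h; rewrite -!natr1 natrD natrM.
  move: (v%:R : R) (2 ^+ n * u) => w y.
  by case: (b n) => /= /andP[? ?]; apply/andP; split; lra.
move=> i; rewrite ltnS leq_eqVlt => /orP[/eqP ->|]; last exact: (IH.2 hn).
by rewrite /binary_digits u01 exprS -mulrA; apply/(step _ hn).
Qed.

(** The witness m is j with its n bits reversed, as [residue] and the binary expansion weigh the
    digits in opposite orders. Only the length of the interval matters for the measure. *)
Lemma residue_binary_digits (R : realType) n j : (j < 2 ^ n)%N ->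
  exists2 m, (m < 2 ^ n)%N &
  [set u : R | residue n (binary_digits u) = j] `&` `[0, 1[ =
  `[m%:R / 2 ^+ n, m.+1%:R / 2 ^+ n[%classic.
Proof.
move=> jn; pose b i := odd (j %/ 2 ^ i).
have bj : residue n b = j by rewrite residue_bits modn_small.
exists (binary_prefix n b); first exact: binary_prefix_lt.
have p0 : 0 < 2 ^+ n :> R by rewrite exprn_gt0.
have vb : (binary_prefix n b).+1%:R <= 2 ^+ n :> R.
  by rewrite -natrX ler_nat binary_prefix_lt.
have v0 : 0 <= (binary_prefix n b)%:R :> R by [].
apply/seteqP; split=> u /=; rewrite !in_itv/= ler_pdivrMr// ltr_pdivlMr//.
  move=> [uj u01]; rewrite mulrC; apply/(binary_digitsP _ _ u01) => i ni.
  by apply: (residue_inj (n := n)) => //; rewrite uj.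
rewrite mulrC => uv; have u01 : 0 <= u < 1.
  move: v0 vb uv; move: (_%:R) (_.+1%:R) => w w' ? ? /andP[wu uw].
  rewrite -(pmulr_rge0 _ p0) -(ltr_pM2l p0) mulr1 (le_trans _ wu)//=.
  exact: lt_le_trans uw _.
by split=> //; rewrite -bj; apply: residue_ext; apply/binary_digitsP.
Qed.

Lemma measurable_binary_digits (R : realType) :
  measurable_fun setT (@binary_digits R : measurableTypeR R -> dyadic_integers).
Proof.
apply: measurable_to_dyadic => n j; rewrite setTI.
(* Off [0, 1[ the digit sequence is constant, so there the preimage is everything or nothing. *)
set S := [set _ | _]; rewrite -[S]setIT -(setUv `[0, 1[) setIUr.
apply: measurableU.
  have [/(residue_binary_digits R)[m _ ->]//|ge] := ltnP j (2 ^ n).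
  rewrite (_ : S = set0) ?set0I//; apply/seteqP; split=> u //= e.
  by have := residue_lt n (binary_digits u); rewrite e ltnNge ge.
have d0 (u : R) : (~` `[0, 1[) u -> binary_digits u = fun=> false.
  move=> /negP; rewrite in_itv/= => /negbTE u01; apply/funext => i.
  by rewrite /binary_digits u01.
have [e|ne] := eqVneq (residue n (fun=> false)) j.
  rewrite (_ : _ `&` _ = ~` `[0, 1[); first exact: measurableC.
  by apply/seteqP; split=> [u []//|u u01]; split=> //; rewrite /S/= d0.
rewrite (_ : _ `&` _ = set0)//; apply/seteqP; split=> [u [Su u01]|//].
by move: Su; rewrite /S/= d0// => /eqP; exact/negP.
Qed.

Section haar.
Context {R : realType}.

Let mI : measurable (`[0, 1[ : set (measurableTypeR R)).
Proof. by []. Qed.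

Definition haar : set dyadic_integers -> \bar R :=
  pushforward (mrestr (@lebesgue_measure R) mI)
    (@binary_digits R : measurableTypeR R -> dyadic_integers).

Let haar0 : haar set0 = 0%E.
Proof. by rewrite /haar /pushforward measure0. Qed.

Let haar_ge0 A : (0 <= haar A)%E.
Proof. by rewrite /haar /pushforward measure_ge0. Qed.

Let haar_sigma_additive : semi_sigma_additive haar.
Proof.
unshelve refine (@measure_semi_sigma_additive _ _ _ _).
exact: measurable_binary_digits.
Qed.

HB.instance Definition _ :=
  isMeasure.Build _ _ _ haar haar0 haar_ge0 haar_sigma_additive.

Lemma haar_residue n j : (j < 2 ^ n)%N ->
  haar [set x | residue n x = j] = (2 ^- n)%:E.
Proof.
move=> /(residue_binary_digits R)[k _ e].
rewrite /haar /pushforward /mrestr e lebesgue_measure_itv/= lte_fin.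
rewrite ltr_pM2r ?invr_gt0 ?exprn_gt0// ltr_nat ltnSn -EFinB -mulrBl.
by rewrite -natrB// subSnn mul1r.
Qed.

Let haar_setT : haar setT = 1%E.
Proof.
have := @haar_residue 0 0 isT; rewrite expr0 invr1 => <-; congr (haar _).
by apply/seteqP; split.
Qed.

HB.instance Definition _ :=
  Measure_isProbability.Build _ _ _ haar haar_setT.

End haar.
Arguments haar : clear implicits.

(** * Measure-preserving maps and conditional expectations *)

Section measure_preserving.
Context d (X : measurableType d) (R : realType) (mu : probability X R).
Variable T : X -> X.
Hypothesis mpT : measure_preserving mu T.

Lemma measure_preserving_ae (P : X -> Prop) :
  {ae mu, forall x, P x} -> {ae mu, forall x, P (T x)}.
Proof.
move=> [N [mN N0 PN]]; exists (T @^-1` N); split.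
- by rewrite -[X in measurable X]setTI; exact: mpT.1.
- by rewrite mpT.2.
- by move=> x /= Px; exact: PN.
Qed.

Lemma measure_preserving_ae_iter (P : X -> Prop) :
  {ae mu, forall x, P x} -> {ae mu, forall x, forall n, P (iter n T x)}.
Proof.
move=> aeP; apply: ae_foralln => n; elim: n => [|n IH] //=.
by move/measure_preserving_ae: IH; apply: filterS => x; rewrite -iterSr.
Qed.

Lemma ge0_integral_measure_preserving (f : X -> \bar R) :
  measurable_fun setT f -> (forall x, 0 <= f x)%E ->
  (\int[mu]_x f (T x) = \int[mu]_x f x)%E.
Proof.
move=> mf f0; rewrite -(@ge0_integral_pushforward _ _ _ _ _ _ mpT.1 mu setT)//.
by apply: eq_measure_integral => [|? A mA _]; [exact: mpT.1|exact: mpT.2].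
Qed.

Lemma integrable_measure_preserving (f : X -> \bar R) :
  mu.-integrable setT f -> mu.-integrable setT (f \o T).
Proof.
move=> /integrableP[mf fi]; apply/integrableP; split.
  exact: measurableT_comp mf mpT.1.
rewrite (ge0_integral_measure_preserving (f := abse \o f))//.
  exact: measurableT_comp.
by move=> x; exact: abse_ge0.
Qed.

Lemma integral_measure_preserving (f : X -> \bar R) :
  mu.-integrable setT f -> (\int[mu]_x f (T x) = \int[mu]_x f x)%E.
Proof.
move=> fi; have [mf _] := integrableP _ _ _ fi.
rewrite -(@integral_pushforward _ _ _ _ _ _ mpT.1 mu setT)//.
  by apply: eq_measure_integral => [|? A mA _]; [exact: mpT.1|exact: mpT.2].
by rewrite preimage_setT; exact: integrable_measure_preserving.
Qed.

End measure_preserving.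

Section full_sigma_algebra.
Context d (X : measurableType d) (R : realType) (mu : probability X R).

Lemma measurable_wrt_full (f : X -> R) :
  measurable_fun setT f -> measurable_wrt (@measurable d X) f.
Proof.
have e : <<s @measurable d X >> = measurable.
  exact/sigma_algebra_id/sigma_algebra_measurable.
by move=> mf _ Y mY; have := mf measurableT Y mY; rewrite /measurable/= e.
Qed.

(** Since f is itself a version, [xget] returns a genuine one; integrable functions with the same
    integral over every measurable set agree almost everywhere. *)
Lemma cond_exp_full (f : X -> R) :
  mu.-integrable setT (EFin \o f) ->
  {ae mu, forall x, cond_exp mu (@measurable d X) f x = f x}.
Proof.
move=> fi.
have : is_cond_exp mu (@measurable d X) f (cond_exp mu (@measurable d X) f).
  apply: (@xgetPex _ (fun=> 0) [set Y | is_cond_exp mu (@measurable d X) f Y]).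
  exists f; split=> //; apply: measurable_wrt_full.
  by have [/measurable_EFinP] := integrableP _ _ _ fi.
move: (cond_exp _ _ _) => Y [_ iY YE].
have [mf _] := integrableP _ _ _ fi.
have := @integral_ae_eq _ _ _ mu _ measurableT (EFin \o f) (EFin \o Y) iY mf.
move=> /(_ (fun E _ mE => YE E mE)).
by apply: filterS => x /(_ I) [].
Qed.

End full_sigma_algebra.

Lemma Lfun2_sqr_integral d (X : measurableType d) (R : realType)
    (mu : probability X R) (f : X -> R) :
  measurable_fun setT f -> (\int[mu]_x (f x ^+ 2)%:E < +oo)%E ->
  f \in Lfun mu 2%:E.
Proof.
move=> mf fi; rewrite inE; apply/andP; split; rewrite inE//=.
rewrite /finite_norm unlock poweR_lty//.
under eq_integral => x _ do rewrite /= powR_mulrn// real_normK ?num_real//.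
by [].
Qed.

(** * Ergodicity of the odometer *)

Section haar_odometer.
Context {R : realType}.
Notation mu := (haar R).

Lemma preimage_odometer_residue n j : (j < 2 ^ n)%N ->
  odometer @^-1` [set x | residue n x = j] =
  [set x | residue n x = ((j + (2 ^ n).-1) %% 2 ^ n)%N].
Proof.
move=> jn; apply/seteqP; split=> x /=.
  by move=> <-; rewrite -residue_odometer_inv odometerK.
rewrite residue_odometer => ->; rewrite -addn1 modnDml addn1 -addnS.
by rewrite prednK ?expn_gt0// modnDr modn_small.
Qed.

(** Taking preimages permutes the cylinders of each level, which all have the same mass, and the
    cylinders determine a finite measure. *)
Lemma odometer_measure_preserving : measure_preserving mu odometer.
Proof.
split; first exact: measurable_odometer.
have [m mE] : exists m : {measure set dyadic_integers -> \bar R},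
    forall A, m A = mu (odometer @^-1` A).
  unshelve eexists (pushforward mu
    (odometer : dyadic_integers -> dyadic_integers)) => //.
  exact: measurable_odometer.
move=> A mA; rewrite -[LHS]mE; apply: dyadic_measure_unique => //.
  by rewrite mE preimage_setT probability_setT ltry.
move=> n j jn; rewrite mE preimage_odometer_residue//.
rewrite haar_residue ?ltn_mod ?expn_gt0//.
exact/esym/haar_residue.
Qed.

Lemma odometer_invertible :
  invertible (odometer : dyadic_integers -> dyadic_integers).
Proof.
exists odometer_inv; split; [exact: odometerK|exact: odometer_invK|].
exact: measurable_odometer_inv.
Qed.

Lemma odometer_ergodic : ergodic mu odometer.
Proof.
move=> A mA TA; pose C n j : set dyadic_integers := [set x | residue n x = j].
have mC n j : measurable (C n j) by exact: measurable_residue.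
(* As A is its own preimage, invariance of [mu] gives A the same share of two neighbouring residue
   classes. *)
have shift n j : (j < 2 ^ n)%N ->
    mu (A `&` C n ((j + (2 ^ n).-1) %% 2 ^ n)%N) = mu (A `&` C n j).
  move=> jn; rewrite /C -preimage_odometer_residue// -[in LHS]TA -preimage_setI.
  by apply: odometer_measure_preserving.2; exact: (measurableI _ _ mA (mC n j)).
have const n j : (j < 2 ^ n)%N -> mu (A `&` C n j) = mu (A `&` C n 0%N).
  elim: j => // j IH jn; have jn' : (j < 2 ^ n)%N := ltnW jn.
  rewrite -shift// addSnnS prednK ?expn_gt0// modnDr modn_small//.
  exact: IH.
have indep n j : (j < 2 ^ n)%N -> mu (A `&` C n j) = (mu A * (2 ^- n)%:E)%E.
  move=> jn.
  have -> : mu A = (\sum_(i < 2 ^ n) mu (A `&` C n i))%E.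
    rewrite -measure_bigsetU_ord//.
    - congr (mu _); rewrite -(bigcup_mkord (2 ^ n) (fun i => A `&` C n i)).
      apply/seteqP; split=> [x Ax|x [i _ []]//].
      by exists (residue n x); [exact: residue_lt|].
    - by move=> i; exact: (measurableI _ _ mA (mC n i)).
    - move=> i k _ _ [x [[_ xi] [_ xk]]].
      by apply: val_inj; move: xi xk; rewrite /C/= => ->.
  under eq_bigr => i _ do rewrite const//.
  rewrite const//.
  have : mu (A `&` C n 0%N) \is a fin_num.
    by apply: fin_num_measure; exact: (measurableI _ _ mA (mC n 0%N)).
  move: (mu _) => [r||]// _; rewrite sumEFin -EFinM sumr_const card_ord.
  by rewrite -[r *+ _]mulr_natr natrX mulfK// expf_neq0// pnatr_eq0.
have Afin : mu A \is a fin_num by exact: fin_num_measure.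
have A0 : 0 <= fine (mu A) by rewrite fine_ge0.
(* The measures sending B to mu (B [&] A) and to mu A * mu B agree on cylinders, hence everywhere;
   at B = A this reads mu A = mu A * mu A. *)
have := @dyadic_measure_unique R (mrestr mu mA) (mscale (NngNum A0) mu).
move=> /(_ _ _ A mA)/=; rewrite /mrestr /mscale/= setIid fineK//.
have mAT : (mu (setT `&` A) < +oo)%E by rewrite setTI ltey_eq Afin.
move=> /(_ mAT) h; have {h} : mu A = (mu A * mu A)%E.
  by apply: h => n j jn; rewrite setIC indep// haar_residue.
move: (mu A) Afin => [r||]// _ [] rr.
have /eqP : r * (r - 1) = 0 by rewrite mulrBr mulr1 -rr subrr.
rewrite mulf_eq0 subr_eq0 => /orP[] /eqP ->; [by left|by right].
Qed.

End haar_odometer.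

(** * The transfer function *)

(* A tent on the residues modulo 64 ^ k = 2 ^ (6 * k), with peak at 4 ^ k; it
   vanishes from 2 * 4 ^ k on because the subtraction is truncated. *)
Definition bump (k : nat) (x : dyadic_integers) : nat :=
  (3 * 2 ^ k * minn (residue (6 * k) x) (2 * 4 ^ k - residue (6 * k) x))%N.

(** Residue 0 is included, although the tent vanishes there, because the step from 0 to 1 already
    climbs: the set must carry the increments as well. *)
Definition bump_support (k : nat) : set dyadic_integers :=
  [set x | (residue (6 * k) x < 2 * 4 ^ k)%N].

Lemma measurable_bump_support k : measurable (bump_support k).
Proof. exact: (measurable_residueP (6 * k) [set r | (r < 2 * 4 ^ k)%N]). Qed.

Lemma expn2_6 k : (2 ^ (6 * k) = 4 ^ k * 4 ^ k * 4 ^ k)%N.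
Proof. by rewrite expnM -!expnMn. Qed.

Lemma bump_le k x : (bump k x <= 3 * 8 ^ k * `[< bump_support k x >])%N.
Proof.
rewrite /bump /bump_support -[8%N]/(2 * 4)%N expnMn.
have -> : `[< [set x | (residue (6 * k) x < 2 * 4 ^ k)%N] x >] =
  (residue (6 * k) x < 2 * 4 ^ k)%N by apply/asboolP/idP.
rewrite mulnA -!mulnA !leq_mul2l /=; apply/orP; right.
move: (residue _ _) (4 ^ k)%N => j a.
by have [lt|ge] := ltnP j (2 * a); lia.
Qed.

Lemma bump_peak k x : residue (6 * k) x = (4 ^ k)%N -> bump k x = (3 * 8 ^ k)%N.
Proof.
rewrite /bump => ->; rewrite -[8%N]/(2 * 4)%N expnMn mulnA.
by rewrite mul2n -addnn addnK minnn.
Qed.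

Lemma bump_odometer k x :
  ((bump k (odometer x) <= bump k x + 3 * 2 ^ k * `[< bump_support k x >]) &&
   (bump k x <= bump k (odometer x) + 3 * 2 ^ k * `[< bump_support k x >]))%N.
Proof.
rewrite /bump /bump_support.
have -> : `[< [set x | (residue (6 * k) x < 2 * 4 ^ k)%N] x >] =
  (residue (6 * k) x < 2 * 4 ^ k)%N by apply/asboolP/idP.
rewrite residue_odometer -!mulnDr !leq_mul2l; move: (residue_lt (6 * k) x).
rewrite expn2_6; move: (residue _ _) => j {x}.
have : (0 < 4 ^ k)%N by rewrite expn_gt0.
have a4 : (4 ^ k = 1 \/ 4 <= 4 ^ k)%N.
  by case: k => [|k]; [left|right; rewrite expnS leq_pmulr// expn_gt0].
move: (4 ^ k)%N a4 => a a4 a0 jN; apply/andP.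
suff [h1 h2] : (minn (j.+1 %% (a * a * a)) (2 * a - j.+1 %% (a * a * a)) <=
    minn j (2 * a - j) + (j < 2 * a))%N /\
  (minn j (2 * a - j) <= minn (j.+1 %% (a * a * a))
    (2 * a - j.+1 %% (a * a * a)) + (j < 2 * a))%N.
  by rewrite h1 h2 !orbT.
(* Wrap-around: the last residue is sent to 0. The tent vanishes at both, because the last residue
   lies beyond 2 * a, or because k = 0 and the only residue is 0. *)
move: jN; rewrite leq_eqVlt => /orP[/eqP e|lt].
  rewrite e modnn; have ja : j = 0%N \/ (2 * a <= j)%N.
    by case: a4 => a4; [left; move: e; rewrite a4; lia|right; nia].
  by case: ja => [->|ja]; [lia|have := ltnNge j (2 * a); lia].
rewrite modn_small//; have [?|?] := ltnP j (2 * a); lia.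
Qed.

Lemma le_limn_esup (R : realType) (u : nat -> \bar R) (l : \bar R) :
  (forall m, exists2 n, (m <= n)%N & (l <= u n)%E) -> (l <= limn_esup u)%E.
Proof.
move=> h; rewrite limn_esup_lim; apply: lime_ge; first exact: is_cvg_esups.
apply: nearW => m; have [n mn lun] := h m.
by apply: (le_trans lun); apply: ereal_sup_ubound; exists n.
Qed.

Section transfer.
Context {R : realType}.
Notation mu := (haar R).

(* Dominates both [transfer] and the squares of its increments. *)
Definition weight (x : dyadic_integers) : \bar R :=
  (\sum_(k <oo) (8 ^+ k * \1_(bump_support k) x)%:E)%E.

(* The supremum is infinite on a null set, where [fine] gives 0. *)
Definition transfer (x : dyadic_integers) : R :=
  fine (esups (fun k => (bump k x)%:R%:E) 0%N).

Let term_ge0 k x : (0 <= (8 ^+ k * \1_(bump_support k) x)%:E :> \bar R)%E.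
Proof. by rewrite lee_fin mulr_ge0 ?exprn_ge0. Qed.

Lemma weight_ge0 x : (0 <= weight x)%E.
Proof. by apply: nneseries_ge0. Qed.

Let measurable_term k :
  measurable_fun setT (fun x => (8 ^+ k * \1_(bump_support k) x)%:E : \bar R).
Proof.
apply/measurable_EFinP; apply: measurable_funM => //.
by apply: measurable_indic; exact: measurable_bump_support.
Qed.

Lemma measurable_weight : measurable_fun setT weight.
Proof. exact: (ge0_emeasurable_sum (P := xpredT)). Qed.

Lemma haar_bump_support k : (mu (bump_support k) <= (2 / 16 ^+ k)%:E)%E.
Proof.
pose C j : set dyadic_integers := [set x | residue (6 * k) x = j].
have mC j : measurable (C j) by exact: measurable_residue.
have -> : bump_support k = \big[setU/set0]_(j < 2 * 4 ^ k) C j.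
  rewrite -(bigcup_mkord (2 * 4 ^ k) C); apply/seteqP; split=> x.
    by move=> lt; exists (residue (6 * k) x).
  by move=> [j lt xj]; rewrite /bump_support/= (xj : residue _ x = j).
rewrite measure_bigsetU_ord//; last first.
  move=> i j _ _ [x [xi xj]]; apply: val_inj.
  by move: xi xj; rewrite /C/= => ->.
apply: (@le_trans _ _ (\sum_(j < 2 * 4 ^ k) (64 ^- k)%:E)%E).
  (* For k = 0 the index j = 1 exceeds the only residue and gives an empty class, whence an
     inequality. *)
  apply: lee_sum => j _; have [lt|ge] := ltnP j (2 ^ (6 * k)).
    by rewrite [X in (X <= _)%E](haar_residue lt) exprM -!natrX.
  rewrite (_ : C j = set0) ?measure0 ?lee_fin ?invr_ge0 ?exprn_ge0//.
  apply/seteqP; split=> x // xj.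
  by have := residue_lt (6 * k) x; rewrite xj ltnNge ge.
rewrite sumEFin sumr_const card_ord lee_fin.
rewrite -[_ *+ (2 * 4 ^ k)]mulr_natl natrM natrX.
have -> : 64 = 4 * 16 :> R by rewrite -natrM.
by rewrite exprMn invfM mulrA mulfK// expf_neq0.
Qed.

Lemma integral_weight : (\int[mu]_x weight x < +oo)%E.
Proof.
rewrite integral_nneseries//.
(* The bound 8 ^ k * (2 / 16 ^ k), rewritten as 4 / 2 ^ k.+1 to match the geometric series of
   [epsilon_trick0]. *)
apply: (@le_lt_trans _ _ (\sum_(k <oo) (4 / (2 ^ k.+1)%:R)%:E)%E); last first.
  by apply: le_lt_trans (epsilon_trick0 _ _) _; rewrite ?ltry.
apply: lee_nneseries => k _; first by move=> _; exact: integral_ge0.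
under eq_integral => x _ do rewrite EFinM.
rewrite ge0_integralZl//; last first.
  by apply/measurable_EFinP/measurable_indic; exact: measurable_bump_support.
rewrite integral_indic ?setIT//; last exact: measurable_bump_support.
apply: (@le_trans _ _ ((8 ^+ k)%:E * (2 / 16 ^+ k)%:E)%E).
  by apply: lee_wpmul2l; [rewrite lee_fin exprn_ge0|exact: haar_bump_support].
rewrite -EFinM lee_fin le_eqVlt; apply/orP; left; apply/eqP.
have -> : 16 = 8 * 2 :> R by rewrite -natrM.
rewrite natrX exprS exprMn.
have : (2 : R) ^+ k != 0 by rewrite expf_neq0.
have : (8 : R) ^+ k != 0 by rewrite expf_neq0.
by move: (8 ^+ k) (2 ^+ k) => a b a0 b0; field; rewrite b0 a0.
Qed.

Lemma weight_ae_lty : {ae mu, forall x, (weight x < +oo)%E}.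
Proof.
have : mu.-integrable setT weight.
  apply/integrableP; split; first exact: measurable_weight.
  under eq_integral => x _ do rewrite gee0_abs ?weight_ge0//.
  exact: integral_weight.
move=> /integrable_ae => /(_ measurableT); apply: filterS => x /(_ I).
by rewrite ge0_fin_numE// weight_ge0.
Qed.

Lemma le_weight k x :
  ((8 ^ k * `[< bump_support k x >])%N%:R%:E <= weight x)%E.
Proof.
apply: (@le_trans _ _ (8 ^+ k * \1_(bump_support k) x)%:E).
  by rewrite natrM natrX indicE; exact: lexx.
apply: le_trans (nneseries_lim_ge k.+1 _); last by [].
by rewrite big_nat_recr//= leeDr// sume_ge0.
Qed.

Lemma esups_bump_le x :
  (0 <= esups (fun k => (bump k x)%:R%:E : \bar R) 0%N <= 3%:E * weight x)%E.
Proof.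
apply/andP; split.
  apply: (@le_trans _ _ (bump 0 x)%:R%:E); first by rewrite lee_fin.
  by apply: ereal_sup_ubound; exists 0%N.
apply: ge_ereal_sup => _ [k _ <-].
apply: (@le_trans _ _ (3%:E * (8 ^ k * `[< bump_support k x >])%N%:R%:E)%E).
  by rewrite -EFinM lee_fin -natrM ler_nat mulnA bump_le.
by apply: lee_wpmul2l => //; exact: le_weight.
Qed.

Lemma transfer_ge0 x : 0 <= transfer x.
Proof. by rewrite fine_ge0//; have /andP[] := esups_bump_le x. Qed.

Lemma measurable_transfer : measurable_fun setT transfer.
Proof.
apply: (measurableT_comp (fine_measurable measurableT)).
apply: (measurable_fun_esups (f := fun k x => (bump k x)%:R%:E)) => k.
apply/measurable_EFinP.
move=> _ Y mY; rewrite setTI.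
exact: (measurable_residueP (6 * k)
  [set r | Y (3 * 2 ^ k * minn r (2 * 4 ^ k - r))%N%:R]).
Qed.

Lemma transfer_le_weight x : ((transfer x)%:E <= 3%:E * weight x)%E.
Proof.
rewrite /transfer; have /andP[] := esups_bump_le x.
(* At an infinite supremum [fine] gives 0, so the bound holds at every point, without an exceptional
   null set. *)
by case: (esups _ _) => [r||] //= _ _; rewrite mule_ge0// weight_ge0.
Qed.

Lemma EFin_transfer x : (weight x < +oo)%E ->
  (transfer x)%:E = esups (fun k => (bump k x)%:R%:E) 0%N.
Proof.
move=> wx; have /andP[h0 hw] := esups_bump_le x.
rewrite fineK// ge0_fin_numE// (le_lt_trans hw)// lte_mul_pinfty//.
Qed.

Lemma bump_le_transfer k x : (weight x < +oo)%E -> (bump k x)%:R <= transfer x.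
Proof.
move=> wx; rewrite -lee_fin EFin_transfer//.
by apply: ereal_sup_ubound; exists k.
Qed.

Lemma transfer_le x b : (weight x < +oo)%E ->
  (forall k, (bump k x)%:R <= b) -> transfer x <= b.
Proof.
move=> wx h; rewrite -lee_fin EFin_transfer//.
by apply: ge_ereal_sup => _ [k _ <-]; rewrite lee_fin.
Qed.

(** A supremum moves by at most the largest move of its members. The k-th tent moves by at most 3 *
    2 ^ k, and only on its support, where (2 ^ k) ^ 2 = 4 ^ k <= 8 ^ k <= [weight x]. *)
Lemma transfer_increment x :
  (weight x < +oo)%E -> (weight (odometer x) < +oo)%E ->
  (((transfer (odometer x) - transfer x) ^+ 2)%:E <= 9%:E * weight x)%E.
Proof.
move=> wx wTx; pose w := fine (weight x).
have wE : weight x = w%:E by rewrite fineK// ge0_fin_numE// weight_ge0.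
have w0 : 0 <= w by rewrite fine_ge0// weight_ge0.
have slope k : (3 * 2 ^ k * `[< bump_support k x >])%N%:R <= 3 * Num.sqrt w.
  rewrite -mulnA natrM ler_wpM2l// -ler_sqr ?nnegrE ?sqrtr_ge0// sqr_sqrtr//.
  rewrite -natrX -lee_fin -wE; apply: le_trans (le_weight k x).
  rewrite lee_fin ler_nat expnMn -expnM [(k * 2)%N]mulnC expnM.
  case: `[< _ >]; last by rewrite exp0n// muln0.
  by rewrite exp1n !muln1; case: k => // k; rewrite leq_exp2r.
have h1 : transfer (odometer x) <= transfer x + 3 * Num.sqrt w.
  apply: transfer_le => // k; have /andP[+ _] := bump_odometer k x.
  rewrite -(ler_nat R) natrD => /le_trans; apply; apply: lerD (slope k).
  exact: bump_le_transfer.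
have h2 : transfer x <= transfer (odometer x) + 3 * Num.sqrt w.
  apply: transfer_le => // k; have /andP[_] := bump_odometer k x.
  rewrite -(ler_nat R) natrD => /le_trans; apply; apply: lerD (slope k).
  exact: bump_le_transfer.
rewrite wE -EFinM lee_fin -[w]sqr_sqrtr//.
rewrite -[9](_ : 3 ^+ 2 = _) -?exprMn; last by ring.
rewrite -real_normK ?num_real// ler_sqr ?nnegrE ?mulr_ge0 ?sqrtr_ge0//.
by rewrite ler_norml; apply/andP; split; lra.
Qed.

Lemma integrable_transfer : mu.-integrable setT (EFin \o transfer).
Proof.
apply/integrableP; split.
  by apply/measurable_EFinP; exact: measurable_transfer.
apply: (@le_lt_trans _ _ (\int[mu]_x (3%:E * weight x))%E).
  apply: ge0_le_integral => //.
  - apply: measurableT_comp => //.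
    by apply/measurable_EFinP; exact: measurable_transfer.
  - by apply: measurable_funeM; exact: measurable_weight.
  - move=> x _; rewrite /= ger0_norm ?transfer_ge0//; exact: transfer_le_weight.
rewrite ge0_integralZl//; [|exact: measurable_weight|].
  by rewrite lte_mul_pinfty// integral_weight.
by move=> x _; exact: weight_ge0.
Qed.

Lemma bump_recurrence k x : (0 < k)%N ->
  exists n, [/\ (64 ^ k <= n)%N, (n <= 4 * 64 ^ k)%N &
                bump k (iter n.+1 odometer x) = (3 * 8 ^ k)%N].
Proof.
move=> k0; have lt := residue_lt (6 * k) x.
have e : (2 ^ (6 * k) = 64 ^ k)%N by rewrite expnM.
rewrite e in lt.
have a4 : (4 ^ k < 64 ^ k)%N by rewrite ltn_exp2r.
have a0 : (0 < 4 ^ k)%N by rewrite expn_gt0.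
(* The time n.+1 carries the residue to 2 * 64 ^ k + 4 ^ k, which is the peak modulo 64 ^ k. The
   extra turn forces n >= 64 ^ k, so that n can be made arbitrarily large. *)
pose n := (64 ^ k + 64 ^ k + 4 ^ k - residue (6 * k) x).-1.
have nE : (residue (6 * k) x + n.+1 = 64 ^ k + 64 ^ k + 4 ^ k)%N.
  by rewrite /n; move: (64 ^ k)%N (4 ^ k)%N (residue _ _) lt a4 a0; lia.
exists n; split.
- by rewrite /n; move: (64 ^ k)%N (4 ^ k)%N (residue _ _) lt a4 a0; lia.
- by rewrite /n; move: (64 ^ k)%N (4 ^ k)%N (residue _ _) lt a4 a0; lia.
apply: bump_peak; rewrite residue_iter nE e -addnA modnDl modnDl.
by rewrite modn_small.
Qed.

End transfer.

(** * The coboundary *)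

(** Each A is the preimage under T of its preimage under the measurable inverse; hence the constant
    filtration satisfies the shift relation. *)
Lemma preimage_measurable_sets d (X : measurableType d) (T : X -> X) :
  invertible T -> measurable_fun setT T ->
  @measurable d X = [set T @^-1` A | A in measurable].
Proof.
move=> [Tinv [TK TinvK mTinv]] mT; apply/seteqP; split=> A /=.
  move=> mA; exists (Tinv @^-1` A).
    by rewrite -[X in measurable X]setTI; exact: mTinv.
  by apply/seteqP; split=> x /=; rewrite TK.
by move=> [B mB <-]; rewrite -[X in measurable X]setTI; exact: mT.
Qed.

Lemma birkhoff_sum_coboundary (R : realType) (X : Type) (T : X -> X)
    (h : X -> R) n x :
  birkhoff_sum T (fun y => h (T y) - h y) n x = h (iter n.+1 T x) - h (T x).
Proof.
rewrite /birkhoff_sum.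
exact: (telescope_sumr (fun i => h (iter i T x)) (ltn0Sn n)).
Qed.

Section coboundary.
Context {R : realType}.
Notation mu := (haar R).

Definition increment (x : dyadic_integers) : R :=
  transfer (odometer x) - transfer x.

Let mp := @odometer_measure_preserving R.

Lemma integrable_transfer_iter n :
  mu.-integrable setT (fun x => (transfer (iter n odometer x))%:E).
Proof.
elim: n => [|n IH]; first exact: integrable_transfer.
apply: (eq_integrable measurableT) (integrable_measure_preserving mp IH).
by move=> x _; rewrite /= -iterSr.
Qed.

Lemma measurable_increment : measurable_fun setT increment.
Proof.
apply: measurable_funB; last exact: measurable_transfer.
exact: measurableT_comp measurable_transfer measurable_odometer.
Qed.

Lemma increment_L20 : L20 mu increment.
Proof.
have mi := measurable_increment; split.
  apply: Lfun2_sqr_integral => //.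
  apply: (@le_lt_trans _ _ (\int[mu]_x (9%:E * weight x))%E).
    apply: ae_ge0_le_integral => //.
    - by move=> x _; rewrite lee_fin sqr_ge0.
    - by apply/measurable_EFinP; exact: measurable_funX.
    - by move=> x _; rewrite mule_ge0// weight_ge0.
    - by apply: measurable_funeM; exact: measurable_weight.
    (* The pointwise bound needs [weight] finite at x and at its image; invariance of the measure
       handles the latter. *)
    - apply: filterS2 weight_ae_lty (measure_preserving_ae mp weight_ae_lty).
      by move=> x wx wTx _; exact: transfer_increment.
  rewrite ge0_integralZl//; [|exact: measurable_weight|].
    by rewrite lte_mul_pinfty// integral_weight.
  by move=> x _; exact: weight_ge0.
(* Integrability of [transfer] allows the mean to be split, and invariance makes the two integrals
   cancel. *)
under eq_integral => x _ do rewrite /increment EFinB.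
rewrite (integralB measurableT (integrable_transfer_iter 1)
  integrable_transfer).
rewrite (integral_measure_preserving mp integrable_transfer)/= subee//.
exact: integrable_fin_num integrable_transfer.
Qed.

Lemma integrable_birkhoff_increment n :
  mu.-integrable setT (EFin \o birkhoff_sum odometer increment n).
Proof.
apply: (eq_integrable measurableT) (integrableB measurableT
  (integrable_transfer_iter n.+1) (integrable_transfer_iter 1)).
by move=> x _; rewrite /= birkhoff_sum_coboundary EFinB.
Qed.

Lemma limn_esup_birkhoff_increment x :
  (forall n, weight (iter n odometer x) < +oo :> \bar R)%E ->
  (1 <= limn_esup (fun n =>
     (birkhoff_sum odometer increment n x / Num.sqrt n%:R)%:E))%E.
Proof.
move=> wx; apply: le_limn_esup => m.
(* Here k >= m makes n >= 64 ^ k exceed m, and k >= [transfer (odometer x)] absorbs the subtracted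
   term: 3 * 8 ^ k - k >= 2 * 8 ^ k >= sqrt n. *)
pose k := maxn m (Num.truncn (transfer (odometer x) : R)).+1.
have km : (m <= k)%N by exact: leq_maxl.
have kh : transfer (odometer x) <= k%:R :> R.
  rewrite (le_trans (ltW (truncnS_gt _)))// ler_nat; exact: leq_maxr.
have k0 : (0 < k)%N by rewrite (leq_trans _ (leq_maxr _ _)).
have [n [kn nk peak]] := bump_recurrence x k0.
have n0 : (0 < n)%N by rewrite (leq_trans _ kn)// expn_gt0.
exists n; first by rewrite (leq_trans km)// (leq_trans _ kn)// ltnW// ltn_expl.
rewrite lee_fin ler_pdivlMr ?sqrtr_gt0 ?ltr0n// mul1r birkhoff_sum_coboundary.
have h8 : 3 * 8 ^+ k <= transfer (iter n.+1 odometer x) :> R.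
  by rewrite -natrX -natrM -peak; exact: bump_le_transfer.
have k8 : k%:R <= 8 ^+ k :> R by rewrite -natrX ler_nat ltnW// ltn_expl.
have sq : Num.sqrt n%:R <= 2 * 8 ^+ k :> R.
  rewrite -(@ger0_norm _ (2 * 8 ^+ k)) ?mulr_ge0 ?exprn_ge0// -sqrtr_sqr.
  rewrite ler_wsqrtr// -!natrX -natrM -natrX ler_nat (leq_trans nk)//.
  by rewrite expnMn leq_mul2l -expnM mulnC expnM leqnn orbT.
move: (Num.sqrt _) (8 ^+ k) (transfer _) h8 k8 sq kh => s e t.
move: (transfer _) (k%:R) => t' c; lra.
Qed.

End coboundary.

Theorem theorem2 (R : realType) :
  exists (d : measure_display) (Omega : measurableType d)
    (mu : probability Omega R) (T : Omega -> Omega)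
    (F : int -> set_system Omega) (f g : Omega -> R),
    invertible T /\ measure_preserving mu T /\ ergodic mu T /\
    filtration F /\
    (forall i : int, F (i + 1) = [set T @^-1` A | A in F i]) /\
    measurable_wrt (F 0) f /\ L20 mu f /\
    g \in Lfun mu 1%:E /\
    {ae mu, forall x, f x = g x - g (T x)} /\
    {ae mu, forall x,
      (1 <= limn_esup (fun n : nat =>
         (cond_exp mu (F 0) (birkhoff_sum T f n) x / Num.sqrt n%:R)%:E))%E}.
Proof.
exists _, dyadic_integers, (haar R), odometer, (fun=> measurable).
exists increment, (fun x => - transfer x).
have mp := @odometer_measure_preserving R.
split; first exact: odometer_invertible.
split; first exact: mp.
split; first exact: odometer_ergodic.
split.
  by split=> [i|i A //]; split=> //; exact: sigma_algebra_measurable.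
split.
  by move=> _; exact: preimage_measurable_sets odometer_invertible mp.1.
split; first by apply: measurable_wrt_full; exact: measurable_increment.
split; first exact: increment_L20.
split.
  apply/Lfun1_integrable.
  rewrite (_ : _ \o _ = \- (EFin \o transfer))%E; last exact/funext.
  by apply: integrableN; exact: integrable_transfer.
split; first by apply: aeW => x; rewrite opprK addrC.
(* The limsup involves all n at once, so the countably many null sets, one for each chosen version,
   are collected first. *)
have aeS : {ae haar R, forall x, forall n,
    cond_exp (haar R) measurable (birkhoff_sum odometer increment n) x =
    birkhoff_sum odometer increment n x}.
  apply: ae_foralln => n.
  exact: cond_exp_full (integrable_birkhoff_increment n).
apply: filterS2 aeS (measure_preserving_ae_iter mp weight_ae_lty) => x eS wx.
under eq_fun do rewrite eS.
exact: limn_esup_birkhoff_increment.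
Qed.
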